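(* Let $P=(\Sigma,A,R)$ be a stratifiable PTSS all of whose rules are $\epsilon$-$nt\mu f\theta$-rules, and let $\sim_\epsilon$ denote $\epsilon$-bisimilarity on the PTS induced by $P$. Then every operator $f\in\Sigma$ is non-expansive: for all closed terms $t_i,t_i'$ and $\epsilon_i\in[0,1]$, $i=1,\dots,\mathsf{r}(f)$, if $t_i\sim_{\epsilon_i}t_i'$ for all $i$, then $f(t_1,\dots,t_{\mathsf{r}(f)})\sim_\epsilon f(t_1',\dots,t_{\mathsf{r}(f)}')$ with $\epsilon=\min\big(\sum_{i=1}^{\mathsf{r}(f)}\epsilon_i,1\big)$.
   Context: Signature $\Sigma=(F,\mathsf{r})$: a set $F$ of function names with arity $\mathsf{r}:F\to\mathbb{N}$. $\mathcal{V}$ (state variables) and $\mathcal{D}$ (distribution variables) are infinite sets; $\zeta$ ranges over $\mathcal{V}\cup\mathcal{D}$. Open state terms $\mathbb{T}(\Sigma)$: variables and $f(t_1,\dots,t_{\mathsf{r}(f)})$; closed terms $T(\Sigma)$ have no variables. $\Delta(T(\Sigma))$ is the set of discrete probability distributions on $T(\Sigma)$; $\delta_t$ is the Dirac distribution at $t$; $\pi(X)=\sum_{t\in X}\pi(t)$; $(\sum_i p_i\pi_i)(t)=\sum_i p_i\pi_i(t)$; $f(\pi_1,\dots,\pi_n)(f(t_1,\dots,t_n))=\prod_i\pi_i(t_i)$. Open distribution terms $\mathbb{DT}(\Sigma)$: the least set containing each $\mu\in\mathcal{D}$, each $\delta_t$ with $t\in\mathbb{T}(\Sigma)$, each $\sum_{i\in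 I}p_i\theta_i$ ($p_i\in(0,1]$, $\sum p_i=1$), and each $f(\theta_1,\dots,\theta_{\mathsf{r}(f)})$. A closed substitution maps state variables to closed terms and distribution variables to distributions, extended by $\sigma(\delta_t)=\delta_{\sigma(t)}$, $\sigma(\sum p_i\theta_i)=\sum p_i\sigma(\theta_i)$, $\sigma(f(\theta_1,\dots))=f(\sigma(\theta_1),\dots)$, and to literals and rules componentwise. Multiplicity: $\mathrm{mult}(t)(x)$ is the number of occurrences of $x$ in a state term $t$. For distribution terms: $\mathrm{mult}(\mu)(\mu)=1$, $\mathrm{mult}(\mu)(\zeta)=0$ for $\zeta\ne\mu$, $\mathrm{mult}(\delta_t)(x)=\mathrm{mult}(t)(x)$, $\mathrm{mult}(\delta_t)(\mu)=0$, $\mathrm{mult}(\sum_{i\in I}p_i\theta_i)(\zeta)=\max_{i\in I}\mathrm{mult}(\theta_i)(\zeta)$, $\mathrm{mult}(f(\theta_1,\dots,\theta_n))(\zeta)=\sum_{i=1}^n\mathrm{mult}(\theta_i)(\zeta)$. A simple $nt\mu f\theta$-rule $\rho$ has the form $\frac{\{t_k\xrightarrow{a_k}\mu_k\mid k\in K\}\ \{t_l\not\xrightarrow{b_l}\mid l\in L\}}{f(x_1,\dots,x_{\mathsf{r}(f)})\xrightarrow{a}\theta}$ with $t_k,t_l\in\mathbb{T}(\Sigma)$, $a_k,b_l,a\in A$, pairwise distinct $\mu_k\in\mathcal{D}$, pairwise distinct $x_1,\dots,x_{\mathsf{r}(f)}\in\mathcal{V}$ (the source variables), $\theta\in\mathbb{DT}(\Sigma)$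 (the target $\mathrm{trg}(\rho)$); $K,L$ may be infinite; $\mathrm{pprem}(\rho)$, $\mathrm{nprem}(\rho)$, $\mathrm{conc}(\rho)$ are its positive premises, negative premises and conclusion. It is an $\epsilon$-$nt\mu f\theta$-rule if for each source variable $x_i$: $\mathrm{mult}(\mathrm{trg}(\rho))(x_i)+\sum_{t_k\xrightarrow{a_k}\mu_k\in\mathrm{pprem}(\rho)}\mathrm{mult}(t_k)(x_i)\cdot\mathrm{mult}(\mathrm{trg}(\rho))(\mu_k)\le1$. A PTSS is $(\Sigma,A,R)$ with $A$ a countable set of actions and $R$ a set of rules; a PTS is $(T(\Sigma),A,\to)$ with $\to\subseteq T(\Sigma)\times A\times\Delta(T(\Sigma))$. A closed literal $t\xrightarrow{a}\pi$ holds in $\to$ if $(t,a,\pi)\in\to$; $t\not\xrightarrow{a}$ holds if no $(t,a,\pi)\in\to$. A stratification of $P$ is a map $S:T(\Sigma)\times A\times\Delta(T(\Sigma))\to\alpha$ ($\alpha$ an ordinal) such that for every $\rho\in R$ and closed substitution $\sigma$: $S(\sigma(t_k)\xrightarrow{a_k}\sigma(\mu_k))\le S(\mathrm{conc}(\sigma(\rho)))$ for all $k\in K$, and $S(\sigma(t_l)\xrightarrow{b_l}\pi)<S(\mathrm{conc}(\sigma(\rho)))$ for all $l\in L$, $\pi\in\Delta(T(\Sigma))$. $P$ is stratifiable if it has one. The induced PTS has transition relation $\bigcup_{\beta<\alpha}\to_\beta$, $\to_\beta=\bigcup_{j\le\mathsf{D}(P)}\to_{\beta,j}$, with $\mathsf{D}(P)$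 the least regular cardinal exceeding $|\mathrm{pprem}(\rho)|$ for all $\rho\in R$, and $\to_{\beta,j}$ the set of $\psi$ with $S(\psi)=\beta$ such that $\psi=\mathrm{conc}(\sigma(\rho))$ for some $\rho\in R$ and closed $\sigma$ with all positive premises of $\sigma(\rho)$ holding in $(\bigcup_{\gamma<\beta}\to_\gamma)\cup(\bigcup_{j'<j}\to_{\beta,j'})$ and all negative premises holding in $\bigcup_{\gamma<\beta}\to_\gamma$ (independent of the chosen stratification). For $\epsilon\in[0,1]$, a symmetric relation $\mathsf{R}\subseteq T(\Sigma)\times T(\Sigma)$ is an $\epsilon$-bisimulation if whenever $t\,\mathsf{R}\,t'$ and $t\xrightarrow{a}\pi$ there is $t'\xrightarrow{a}\pi'$ with $\pi(X)\le\pi'(\mathsf{R}(X))+\epsilon$ for all $X\subseteq T(\Sigma)$, where $\mathsf{R}(X)=\{y\mid\exists x\in X.\,x\,\mathsf{R}\,y\}$; $\sim_\epsilon$ is the union of all $\epsilon$-bisimulations. *)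

(* Defs.v *)
(* MathComp / MathComp-Analysis *)
From HB Require Import structures.
From mathcomp Require Import all_boot all_order all_algebra.
From mathcomp Require Import all_classical all_reals ereal esum.

Set Implicit Arguments.
Unset Strict Implicit.
Unset Printing Implicit Defensive.

Import Order.TTheory GRing.Theory Num.Theory.

Local Open Scope classical_set_scope.
Local Open Scope ring_scope.

Section esum_facts.
Context {R : realType}.
Local Open Scope ereal_scope.

Lemma esumZ (T : choiceType) (a : T -> \bar R) (c : R) :
  (0 <= c)%R -> (forall i, 0 <= a i) ->
  \esum_(i in [set: T]) (c%:E * a i) = c%:E * \esum_(i in [set: T]) a i.
Proof.
have le (b : T -> \bar R) (d : R) : (0 <= d)%R -> (forall i, 0 <= b i) ->
    \esum_(i in [set: T]) (d%:E * b i) <= d%:E * \esum_(i in [set: T]) b i.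
  move=> d0 b0; apply: ge_ereal_sup => _ [X [finX XI] <-].
  rewrite -ge0_mule_fsumr//; apply: lee_wpmul2l; first by rewrite lee_fin.
  by apply: ereal_sup_ubound; exists X.
move=> c0 a0; apply/eqP; rewrite eq_le le//=.
have [->|cn0] := eqVneq c 0%R.
  by rewrite mul0e esum_ge0// => i _; rewrite mul0e.
have cp : (0 < c)%R by rewrite lt_def cn0.
have ca0 i : 0 <= c%:E * a i by rewrite mule_ge0 ?lee_fin.
have := le (fun i => c%:E * a i) (c^-1)%R.
rewrite invr_ge0 => /(_ c0 ca0).
under [X in X <= _ -> _]eq_esum do rewrite muleA -EFinM mulVf// mul1e.
by rewrite lee_pdivlMl.
Qed.

Lemma esum_swap (T1 T2 : choiceType) (I : set T1) (J : set T2)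
    (a : T1 -> T2 -> \bar R) : (forall i j, 0 <= a i j) ->
  \esum_(i in I) \esum_(j in J) a i j = \esum_(j in J) \esum_(i in I) a i j.
Proof.
move=> a0; rewrite !esum_esum//.
apply: (@reindex_esum _ _ _ _ _ (fun k : T2 * T1 => (k.2, k.1))).
split=> [[j i] /= []//|[j i] [j' i'] /= _ _ [-> ->]//|[i j] /= [Ii Jj]].
by exists (j, i).
Qed.

End esum_facts.

Section distributions.
Context {R : realType}.

Record pdist (T : choiceType) := PDist {
  pmf :> T -> R;
  pmf_ge0 : forall t, 0 <= pmf t;
  pmf_sum1 : (\esum_(t in [set: T]) (pmf t)%:E = 1)%E }.

Definition prob (T : choiceType) (pi : pdist T) (X : set T) : \bar R :=
  (\esum_(t in X) (pi t)%:E)%E.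

Section constructions.
Variable T : choiceType.

Lemma pdirac_ge0 (t : T) (u : T) : 0 <= (u == t)%:R :> R.
Proof. by rewrite ler0n. Qed.

Lemma pdirac_sum1 (t : T) :
  (\esum_(u in [set: T]) ((u == t)%:R : R)%:E = 1)%E.
Proof.
rewrite -[RHS](_ : \esum_(u in [set t]) ((u == t)%:R : R)%:E = 1)%E.
  rewrite [RHS]esum_mkcond; apply: eq_esum => u _.
  have [->|ut] := eqVneq u t; first by rewrite mem_set.
  by rewrite memNset //=; apply/eqP.
by rewrite esum_set1 eqxx// lee_fin.
Qed.

Definition pdirac (t : T) : pdist T := PDist (pdirac_ge0 t) (pdirac_sum1 t).

Lemma pmf_le1 (pi : pdist T) t : pi t <= 1.
Proof.
rewrite -lee_fin -(pmf_sum1 pi) -(@esum_set1 _ _ t (fun u => (pi u)%:E)).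
  rewrite [leLHS]esum_mkcond; apply: le_esum => u _.
  by case: ifP => // _; rewrite lee_fin pmf_ge0.
by rewrite lee_fin pmf_ge0.
Qed.

Section convex_combination.
Variables (I : set nat) (p : nat -> R).
Hypothesis p01 : forall i, I i -> 0 < p i <= 1.
Hypothesis p1 : (\esum_(i in I) (p i)%:E = 1)%E.
Variable pi : nat -> pdist T.

Definition pconv_pmf (t : T) : R :=
  fine (\esum_(i in I) (p i * pi i t)%:E)%E.

Let term_ge0 i t : I i -> 0 <= p i * pi i t.
Proof. by move=> /p01 /andP[/ltW ? _]; rewrite mulr_ge0 ?pmf_ge0. Qed.

Lemma pconv_pmfE t :
  (pconv_pmf t)%:E = (\esum_(i in I) (p i * pi i t)%:E)%E.
Proof.
rewrite fineK// ge0_fin_numE; last first.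
  by apply: esum_ge0 => i Ii; rewrite lee_fin term_ge0.
apply: (@le_lt_trans _ _ 1%E); last exact: ltry.
rewrite -p1; apply: le_esum => i Ii; rewrite lee_fin ler_piMr ?pmf_le1//.
by have /andP[/ltW] := p01 Ii.
Qed.

Lemma pconv_ge0 t : 0 <= pconv_pmf t.
Proof.
by rewrite -lee_fin pconv_pmfE; apply: esum_ge0 => i Ii; rewrite lee_fin term_ge0.
Qed.

Lemma pconv_sum1 : (\esum_(t in [set: T]) (pconv_pmf t)%:E = 1)%E.
Proof.
under eq_esum do rewrite pconv_pmfE esum_mkcond.
rewrite esum_swap; last first.
  by move=> t i; case: ifP => // /set_mem Ii; rewrite lee_fin term_ge0.
rewrite -p1 [RHS]esum_mkcond; apply: eq_esum => i _.
case: ifP => [/set_mem Ii|_]; last by rewrite esum1.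
under eq_esum do rewrite EFinM.
rewrite esumZ ?pmf_sum1 ?mule1//; first by have /andP[/ltW] := p01 Ii.
by move=> t; rewrite lee_fin pmf_ge0.
Qed.

Definition pconv : pdist T := PDist pconv_ge0 pconv_sum1.

End convex_combination.

Lemma esum_prod1 n (pi : 'I_n -> pdist T) :
  (\esum_(ts in [set: 'I_n -> T]) (\prod_(i < n) pi i (ts i))%:E = 1)%E.
Proof.
elim: n pi => [|n IHn] pi.
  have ts0 : 'I_0 -> T by case.
  rewrite (_ : [set: _] = [set ts0]); first by rewrite esum_set1 big_ord0 ?lee_fin.
  by apply/seteqP; split => // ts _; apply/funext; case.
pose e (k : T * ('I_n -> T)) (i : 'I_n.+1) :=
  if unlift ord0 i is Some j then k.2 j else k.1.
have e_bij : set_bij ([set: T] `*`` fun=> [set: 'I_n -> T]) [set: 'I_n.+1 -> T] e.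
  split=> // [[x ts] [y us] _ _ exy|ts _].
    congr pair; first by have := congr1 (@^~ ord0) exy; rewrite /e unlift_none.
    apply/funext => j.
    by have := congr1 (@^~ (lift ord0 j)) exy; rewrite /e liftK.
  exists (ts ord0, ts \o lift ord0) => //; apply/funext => i.
  by rewrite /e; case: unliftP => [j|] ->.
rewrite (reindex_esum _ _ _ _ e_bij).
under eq_esum => k _.
  rewrite big_ord_recl {1}/e unlift_none.
  under eq_bigr do rewrite /e liftK.
  over.
pose a x (ts : 'I_n -> T) :=
  (pi ord0 x * \prod_(i < n) pi (lift ord0 i) (ts i))%:E.
rewrite -(esum_esum (a := a)); last first.
  move=> x ts _ _; rewrite lee_fin mulr_ge0 ?pmf_ge0//.
  by apply: prodr_ge0 => i _; exact: pmf_ge0.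
rewrite -(pmf_sum1 (pi ord0)); apply: eq_esum => x _.
under eq_esum do rewrite /a EFinM.
rewrite esumZ ?pmf_ge0 ?IHn ?mule1// => ts.
by rewrite lee_fin prodr_ge0// => i _; exact: pmf_ge0.
Qed.

End constructions.
End distributions.
Arguments pdist R T : clear implicits.

Record signature := Signature { fname : choiceType; arity : fname -> nat }.

Section terms.
Variable Sig : signature.

Inductive term (V : Type) : Type :=
| Var of V
| App (f : fname Sig) of ('I_(arity f) -> term V).

HB.instance Definition _ (V : Type) := gen_eqMixin (term V).
HB.instance Definition _ (V : Type) := gen_choiceMixin (term V).

Definition cterm := term void.
HB.instance Definition _ := Choice.on cterm.

Fixpoint tsubst (V : Type) (s : V -> cterm) (t : term V) : cterm :=
  match t with
  | Var x => s x
  | App f ts => App (fun i => tsubst s (ts i))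
  end.

Fixpoint tmult (V : eqType) (t : term V) (x : V) : nat :=
  match t with
  | Var y => (y == x)
  | App f ts => \sum_(i < arity f) tmult (ts i) x
  end.

Definition args_of (V : Type) (f : fname Sig) (t : term V) :
    option ('I_(arity f) -> term V) :=
  match t with
  | Var _ => None
  | App g ts =>
    match g =P f with
    | ReflectT e => Some (ecast h ('I_(arity h) -> term V) e ts)
    | ReflectF _ => None
    end
  end.

Lemma args_ofK V f (ts : 'I_(arity f) -> term V) : args_of f (App ts) = Some ts.
Proof. by rewrite /=; case: eqP => // e; rewrite (eq_axiomK e). Qed.

Lemma args_ofP V f (t : term V) ts : args_of f t = Some ts -> t = App ts.
Proof.
case: t => //= g us; case: eqP => // e; case: f / e ts => ts [] /= ->.
by [].
Qed.

Section lifted_operator.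
Context {R : realType}.
Variables (f : fname Sig) (pi : 'I_(arity f) -> pdist R cterm).

Definition papp_pmf (t : cterm) : R :=
  if args_of f t is Some ts then \prod_(i < arity f) pi i (ts i) else 0.

Lemma papp_ge0 t : 0 <= papp_pmf t.
Proof.
rewrite /papp_pmf; case: args_of => // ts.
by apply: prodr_ge0 => i _; exact: pmf_ge0.
Qed.

Lemma papp_sum1 : (\esum_(t in [set: cterm]) (papp_pmf t)%:E = 1)%E.
Proof.
rewrite -(esum_prod1 pi).
transitivity (\esum_(t in range (@App void f)) (papp_pmf t)%:E)%E.
  rewrite [RHS]esum_mkcond; apply: eq_esum => t _.
  case: ifPn => // /negP tNr; rewrite /papp_pmf.
  case E: args_of => [ts|//]; case: tNr; apply/mem_set.
  by exists ts => //; rewrite (args_ofP E).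
rewrite esum_image; first by apply: eq_esum => ts _; rewrite /papp_pmf args_ofK.
move=> ts us _ _ /(congr1 (args_of f)).
by rewrite !args_ofK => -[].
Qed.

Definition papp : pdist R cterm := PDist papp_ge0 papp_sum1.

End lifted_operator.
End terms.
Arguments Var {Sig V}.
Arguments App {Sig V} f.

Section ptss.
Variables (R : realType) (Sig : signature) (A : countType) (V D : choiceType).

(* In [DSum], positivity of the weights forces the index set to be countable,
   so it is taken to be a subset of nat; the values of [p] and [th] outside [J]
   are irrelevant. *)
Inductive dterm : Type :=
| DVar of D
| DDirac of term Sig V
| DSum (J : set nat) (p : nat -> R) (th : nat -> dterm)
    (p01 : forall i, J i -> 0 < p i <= 1)
    (p1 : (\esum_(i in J) (p i)%:E = 1)%E)
| DApp (f : fname Sig) of ('I_(arity f) -> dterm).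

Record csubst := CSubst {
  svar : V -> cterm Sig;
  dvar : D -> pdist R (cterm Sig) }.

Fixpoint dsubst (s : csubst) (th : dterm) : pdist R (cterm Sig) :=
  match th with
  | DVar mu => dvar s mu
  | DDirac t => pdirac (tsubst (svar s) t)
  | DSum J p th p01 p1 => pconv p01 p1 (fun i => dsubst s (th i))
  | DApp f th => papp (fun i => dsubst s (th i))
  end.

(* The maximum over the summands is a supremum in \bar R: for an infinite index
   set it need not be attained and may be +oo. *)
Fixpoint dmult (th : dterm) (z : V + D) : \bar R :=
  match th with
  | DVar mu => ((inr mu == z)%:R)%:E
  | DDirac t => if z is inl x then ((tmult t x)%:R)%:E else 0%E
  | DSum J p th _ _ => ereal_sup [set dmult (th i) z | i in J]
  | DApp f th => (\sum_(i < arity f) dmult (th i) z)%E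
  end.

Definition pos_premise := (term Sig V * A * D)%type.
Definition neg_premise := (term Sig V * A)%type.

(* Simple ntmuftheta-rules. As the mu_k are pairwise distinct, the index set K
   is in bijection with the set of positive premises. *)
Record rule := Rule {
  pprem : set pos_premise;
  nprem : set neg_premise;
  rop : fname Sig;
  rvar : 'I_(arity rop) -> V;
  ract : A;
  trg : dterm;
  pprem_distinct : forall p q, pprem p -> pprem q -> p.2 = q.2 -> p = q;
  rvar_distinct : injective rvar }.

Definition eps_rule (rho : rule) : Prop :=
  forall i : 'I_(arity (rop rho)),
    (dmult (trg rho) (inl (rvar i)) +
     \esum_(p in pprem rho)
       (((tmult p.1.1 (rvar i))%:R)%:E * dmult (trg rho) (inr p.2)) <= 1)%E.

Definition ptss := set rule.

Definition transition := (cterm Sig * A * pdist R (cterm Sig))%type.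

Definition pos_inst (s : csubst) (p : pos_premise) : transition :=
  (tsubst (svar s) p.1.1, p.1.2, dvar s p.2).

Definition neg_holds (s : csubst) (n : neg_premise) (tr : set transition) : Prop :=
  forall pi, ~ tr (tsubst (svar s) n.1, n.2, pi).

Definition conc (s : csubst) (rho : rule) : transition :=
  (tsubst (svar s) (App (rop rho) (fun i => Var (rvar i))), ract rho,
   dsubst s (trg rho)).

End ptss.

(* A well-ordered set stands for the ordinal it is order-isomorphic to. *)
Record wellOrder := WellOrder {
  wo_disp : Order.disp_t;
  wo_sort :> orderType wo_disp;
  wo_wf : well_founded (fun x y : wo_sort => (x < y)%O) }.

Section cardinals.
Variable O : wellOrder.

(* An element k of a well-order stands for the ordinal [below k]. *)
Definition below (k : O) : set O := [set j | (j < k)%O].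

Definition is_cardinal (k : O) : Prop :=
  forall j, (j < k)%O -> ~ (below k #<= below j)%card.

Definition is_regular_cardinal (k : O) : Prop :=
  [/\ is_cardinal k, infinite_set (below k) &
      forall X : set O, X `<=` below k -> ~ (below k #<= X)%card ->
        exists2 d, (d < k)%O & forall x, X x -> (x < d)%O].

End cardinals.

Section semantics.
Variables (R : realType) (Sig : signature) (A : countType) (V D : choiceType).
Variable P : ptss R Sig A V D.
Local Notation transition := (transition R Sig A).

Definition exceeds_pprem (O : wellOrder) (k : O) : Prop :=
  forall rho, P rho -> ~ (below k #<= pprem rho)%card.

Definition is_degree (O : wellOrder) (k : O) : Prop :=
  [/\ is_regular_cardinal k, exceeds_pprem k &
      forall j : O, is_regular_cardinal j -> exceeds_pprem j -> (k <= j)%O].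

Definition is_stratification (W : wellOrder) (S : transition -> W) : Prop :=
  forall rho (s : csubst R Sig V D), P rho ->
    (forall p, pprem rho p -> (S (pos_inst s p) <= S (conc s rho))%O) /\
    (forall n, nprem rho n -> forall pi,
       (S (tsubst (svar s) n.1, n.2, pi) < S (conc s rho))%O).

Section induced.
Variables (W : wellOrder) (S : transition -> W) (O : wellOrder) (k : O).

Definition derivable (b : W) (lower prev : set transition) : set transition :=
  [set psi | S psi = b /\
     exists rho (s : csubst R Sig V D),
       [/\ P rho, psi = conc s rho,
           forall p, pprem rho p -> (lower `|` prev) (pos_inst s p) &
           forall n, nprem rho n -> neg_holds s n lower]].

Definition stage (b : W) (lower : set transition) : O -> set transition :=
  Fix (wo_wf (w:=O)) (fun=> set transition)
    (fun j rec => derivable b lower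
       [set psi | exists j' (h : (j' < j)%O), rec j' h psi]).

Definition stratum : W -> set transition :=
  Fix (wo_wf (w:=W)) (fun=> set transition)
    (fun b rec =>
       let lower := [set psi | exists c (h : (c < b)%O), rec c h psi] in
       \bigcup_(j in [set j : O | (j <= k)%O]) stage b lower j).

Definition induced : set transition := \bigcup_b stratum b.

End induced.
End semantics.

Section bisimulation.
Variables (R : realType) (Sig : signature) (A : countType).
Variable tr : set (transition R Sig A).

Definition rel_image (Q : cterm Sig -> cterm Sig -> Prop) (X : set (cterm Sig)) :=
  [set y | exists2 x, X x & Q x y].

Definition is_eps_bisim (e : R) (Q : cterm Sig -> cterm Sig -> Prop) : Prop :=
  (forall t t', Q t t' -> Q t' t) /\
  forall t t' a pi, Q t t' -> tr (t, a, pi) ->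
    exists2 pi', tr (t', a, pi') &
      forall X, (prob pi X <= prob pi' (rel_image Q X) + e%:E)%E.

Definition eps_bisimilar (e : R) (t t' : cterm Sig) : Prop :=
  exists2 Q, is_eps_bisim e Q & Q t t'.

End bisimulation.

(* Main.v *)
(* The candidate relations are the closures of the [~_e] under all operators,
   with the errors of the arguments added up and capped at [1]; the closure at
   level [e] is shown to be an [e]-bisimulation. A transition of [f(ts)] derived
   by a rule is mimicked from [f(ts')] by the same rule, with the distributions
   obtained by induction for the positive premises. The error of the target is
   additive over lifted operators (replace the factors of a product
   distribution one at a time) and bounded by the largest summand in a convex
   combination, so it is at most the multiplicity sum that [eps_rule] bounds by
   one copy of each argument's error. *)
Require Import Defs.
From HB Require Import structures.
From mathcomp Require Import all_boot all_order all_algebra.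
From mathcomp Require Import all_classical all_reals ereal esum.
Import Order.TTheory GRing.Theory Num.Theory.
Local Open Scope classical_set_scope.
Local Open Scope ring_scope.

(** * Induced transitions as a fixed point of provability *)

Section provability.
Set Implicit Arguments.
Unset Strict Implicit.
Variables (R : realType) (Sig : signature) (A : countType) (V D : choiceType).
Variable P : ptss R Sig A V D.
Local Notation transition := (transition R Sig A).

(** Proof trees without strata or stages. The oracle [N] settles the negative premises and can be
    varied independently of the positive part. *)
Inductive provable (N : set transition) : transition -> Prop :=
| Provable rho (s : csubst R Sig V D) of P rho &
    (forall p, pprem rho p -> provable N (pos_inst s p)) &
    (forall n, nprem rho n -> neg_holds s n N) : provable N (conc s rho).

Lemma provable_antitone (N N' : set transition) : N' `<=` N ->
  provable N `<=` provable N'.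
Proof.
move=> N'N psi; elim=> rho s Prho _ IH neg; apply: Provable => // n /neg h pi.
by move=> /N'N; exact: h.
Qed.

Variables (W : wellOrder) (S : transition -> W).
Hypothesis S_strat : is_stratification P S.

(* Strata up to [b] only query the oracle strictly below [b]. *)
Lemma provable_below (N : set transition) b psi :
  provable [set phi | N phi /\ (S phi < b)%O] psi -> (S psi <= b)%O ->
  provable N psi.
Proof.
elim=> rho s Prho _ IH neg Sb; have [Spos Sneg] := S_strat s Prho.
apply: Provable => // [p pp|n nn pi Npi].
  by apply: IH => //; apply: le_trans Sb; exact: Spos.
by apply: (neg n nn pi); split=> //; apply: lt_le_trans Sb; exact: Sneg.
Qed.

Variables (O : wellOrder) (deg : O).
Local Notation lower b :=
  [set psi | exists c (h : (c < b)%O), stratum P S deg c psi].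

Lemma stageE b lo (j : O) : stage P S b lo j =
  derivable P S b lo
    [set psi | exists (j' : O) (h : (j' < j)%O), stage P S b lo j' psi].
Proof.
rewrite /stage Fix_eq// => x f g fg; congr derivable.
by apply/seteqP; split=> psi [j' [h]]; rewrite ?fg -?fg => ?; exists j', h; rewrite ?fg -?fg.
Qed.

Lemma stratumE b : stratum P S deg b =
  \bigcup_(j in [set j : O | (j <= deg)%O]) stage P S b (lower b) j.
Proof.
rewrite /stratum Fix_eq// => x f g fg.
suff -> : f = g by [].
by apply: functional_extensionality_dep => c; apply/funext => h.
Qed.

Lemma stratum_level b psi : stratum P S deg b psi -> S psi = b.
Proof. by rewrite stratumE => -[j _]; rewrite stageE => -[]. Qed.

Lemma inducedE psi : induced P S deg psi <-> stratum P S deg (S psi) psi.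
Proof.
split=> [[b _ bpsi]|h]; last by exists (S psi).
by rewrite (stratum_level bpsi).
Qed.

Lemma lowerE b psi : lower b psi <-> induced P S deg psi /\ (S psi < b)%O.
Proof.
split=> [[c [h cpsi]]|[/inducedE h Sb]]; last by exists (S psi), Sb.
by rewrite (stratum_level cpsi); split=> //; exists c.
Qed.

(** Nested induction on stratum and stage. Negative premises query only strata below [b], where
    [lower b] agrees with the induced relation. *)
Lemma induced_provable : induced P S deg `<=` provable (induced P S deg).
Proof.
move=> psi [b _]; elim/(well_founded_ind (wo_wf (w:=W))): b psi => b IHb psi.
rewrite stratumE => -[j _].
elim/(well_founded_ind (wo_wf (w:=O))): j psi => j IHj psi.
rewrite stageE => -[Spsi [rho [s [Prho Epsi pos neg]]]]; subst psi.
apply: Provable => // [p /pos[[c [h]]|[j' [h]]]|n nn pi ind].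
- exact: IHb.
- exact: IHj.
- apply: (neg n nn pi); apply/lowerE; split => //; rewrite -Spsi.
  by have [_] := S_strat s Prho; exact.
Qed.

Hypothesis deg_P : is_degree P deg.

(** By regularity of [deg]: the stages of the premises form a set no larger than [pprem rho], too
    small to be cofinal in [deg], so one stage below [deg] follows them all. *)
Lemma stage_below_degree b lo rho (s : csubst R Sig V D) :
  P rho -> S (conc s rho) = b ->
  (forall p, pprem rho p ->
     lo (pos_inst s p) \/ exists2 j : O, (j < deg)%O & stage P S b lo j (pos_inst s p)) ->
  (forall n, nprem rho n -> neg_holds s n lo) ->
  exists2 j : O, (j < deg)%O & stage P S b lo j (conc s rho).
Proof.
have [[_ deg_inf deg_reg] deg_exceeds _] := deg_P.
move=> Prho Sb pos neg.
have [j0 j0deg] := infinite_setN0 deg_inf.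
(* [j0] is the default stage for non-premises and for premises that hold in [lo]. *)
have /choice[J JP] p : exists j, (j < deg)%O /\
    (pprem rho p -> lo (pos_inst s p) \/ stage P S b lo j (pos_inst s p)).
  have [pp|npp] := pselect (pprem rho p); last by exists j0; split.
  have [lop|[j jdeg jp]] := pos _ pp; first by exists j0; split=> // _; left.
  by exists j; split=> // _; right.
have [_ [p _ <-]||d ddeg Xd] := deg_reg (J @` pprem rho).
- exact: (JP p).1.
- move=> /card_le_trans/(_ (card_image_le _ _)); exact: deg_exceeds.
exists d => //; rewrite stageE; split=> //; exists rho, s; split=> // p pp.
have [lop|jp] := (JP p).2 pp; [by left|right].
by exists (J p); split=> //; apply: Xd; exists p.
Qed.

Lemma provable_induced : provable (induced P S deg) `<=` induced P S deg.
Proof.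
move=> psi; elim=> rho s Prho _ pos neg; set b := S (conc s rho).
have [Spos Sneg] := S_strat s Prho.
have {}neg n : nprem rho n -> neg_holds s n (lower b).
  by move=> nn pi /lowerE[/neg]; exact.
(* A stratum includes stage [deg] itself, but the premises used there lie in [lower b] or at stages
   below [deg], so it adds nothing new. *)
have stage_lt j phi : (j <= deg)%O -> stage P S b (lower b) j phi ->
    exists2 j', (j' < deg)%O & stage P S b (lower b) j' phi.
  rewrite le_eqVlt => /orP[/eqP ->|jd jphi]; last by exists j.
  rewrite {1}stageE => -[Sphi [rho' [s' [Prho' Ephi pos' neg']]]]; subst phi.
  apply: stage_below_degree => // p /pos'[lop|[j' [h jp]]]; first by left.
  by right; exists j'.
have [p pp|j jdeg jpsi] :=
    @stage_below_degree b (lower b) rho s Prho erefl _ neg; last first.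
- by exists b => //; rewrite stratumE; exists j => //; exact: ltW.
- have := Spos _ pp; rewrite le_eqVlt => /orP[/eqP Sp|Sp].
    right; have /inducedE := pos _ pp; rewrite Sp stratumE => -[j jd].
    exact: stage_lt.
  by left; apply/lowerE; split=> //; exact: pos.
Qed.

End provability.

(** * Approximate lifting of relations to distributions *)

Section lifting.
Set Implicit Arguments.
Unset Strict Implicit.
Context {R : realType}.
Local Open Scope ereal_scope.

Lemma prob_ge0 (T : choiceType) (pi : pdist R T) X : 0 <= prob pi X.
Proof. by apply: esum_ge0 => t _; rewrite lee_fin pmf_ge0. Qed.

Lemma sub_esum (T : choiceType) (X Y : set T) (a : T -> \bar R) :
  (forall t, 0 <= a t) -> X `<=` Y -> \esum_(t in X) a t <= \esum_(t in Y) a t.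
Proof.
move=> a0 XY; rewrite esum_mkcond [leRHS]esum_mkcond; apply: le_esum => t _.
case: ifPn => [/set_mem Xt|_]; first by rewrite mem_set//; exact: XY.
by case: ifP.
Qed.

Lemma prob_sub (T : choiceType) (pi : pdist R T) X Y :
  X `<=` Y -> prob pi X <= prob pi Y.
Proof. by apply: sub_esum => t; rewrite lee_fin pmf_ge0. Qed.

Lemma prob_le1 (T : choiceType) (pi : pdist R T) X : prob pi X <= 1.
Proof. by rewrite -(pmf_sum1 pi); exact: prob_sub. Qed.

Lemma prob_dirac (T : choiceType) (t : T) X :
  prob (pdirac t : pdist R T) X = ((t \in X)%:R)%:E.
Proof.
have [/set_mem Xt|/negP nXt] := boolP (t \in X).
  apply/eqP; rewrite eq_le prob_le1/=.
  apply: le_trans (prob_sub (pdirac t) (X := [set t]) _); last by move=> _ ->.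
  by rewrite /prob esum_set1 /= eqxx ?lee_fin.
rewrite /prob esum1// => u Xu /=.
by case: eqP => // ut; case: nXt; rewrite -ut; exact/mem_set.
Qed.

Lemma esumZ_cond (T : choiceType) (X : set T) (a : T -> \bar R) (c : R) :
  (0 <= c)%R -> (forall t, X t -> 0 <= a t) ->
  \esum_(t in X) (c%:E * a t) = c%:E * \esum_(t in X) a t.
Proof.
move=> c0 a0; rewrite esum_mkcond [in RHS]esum_mkcond -esumZ//.
  by apply: eq_esum => t _; case: ifP => //; rewrite mule0.
by move=> t; case: ifP => // /set_mem/a0.
Qed.

Lemma prob_conv (T : choiceType) (J : set nat) (p : nat -> R)
    (p01 : forall i, J i -> (0 < p i <= 1)%R)
    (p1 : \esum_(i in J) (p i)%:E = 1) (pi : nat -> pdist R T) X :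
  prob (pconv p01 p1 pi) X = \esum_(i in J) ((p i)%:E * prob (pi i) X).
Proof.
have p0 i : J i -> (0 <= p i)%R by move=> /p01/andP[/ltW].
rewrite /prob; under eq_esum do rewrite /= pconv_pmfE// esum_mkcond.
rewrite esum_swap; last first.
  by move=> t i; case: ifP => // /set_mem/p0 Ji; rewrite lee_fin mulr_ge0 ?pmf_ge0.
rewrite [RHS]esum_mkcond; apply: eq_esum => i _.
case: ifP => [/set_mem/p0 Ji|_]; last by rewrite esum1.
under eq_esum do rewrite EFinM.
by rewrite esumZ_cond// => t _; rewrite lee_fin pmf_ge0.
Qed.

(** * Product distributions on tuples *)

Section product.
Variable T : choiceType.

Definition fcons n (x : T) (ts : 'I_n -> T) (i : 'I_n.+1) : T :=
  if unlift ord0 i is Some j then ts j else x.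

Definition prod_prob n (pi : 'I_n -> pdist R T) (X : set ('I_n -> T)) : \bar R :=
  \esum_(ts in X) (\prod_(i < n) pi i (ts i))%:E.

Lemma prod_pmf_ge0 n (pi : 'I_n -> pdist R T) (ts : 'I_n -> T) :
  (0 <= \prod_(i < n) pi i (ts i))%R.
Proof. by apply: prodr_ge0 => i _; exact: pmf_ge0. Qed.

Lemma fcons_eta n (ts : 'I_n.+1 -> T) : fcons (ts ord0) (ts \o lift ord0) = ts.
Proof. by apply/funext => i; rewrite /fcons; case: unliftP => [j|] ->. Qed.

(** Tonelli with the head outermost: the tail factors can be changed for each fixed head. *)
Lemma prod_probS n (pi : 'I_n.+1 -> pdist R T) X :
  prod_prob pi X = \esum_(x in [set: T])
    ((pi ord0 x)%:E *
     prod_prob (pi \o lift ord0) [set ts | X (fcons x ts)]).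
Proof.
pose e (k : T * ('I_n -> T)) := fcons k.1 k.2.
have e_bij : set_bij ([set: T] `*`` fun x => [set ts | X (fcons x ts)]) X e.
  split=> [[x ts] [_ /=]//|[x ts] [y us] _ _ exy|ts Xts].
    congr pair; first by have := congr1 (@^~ ord0) exy; rewrite /e /fcons unlift_none.
    apply/funext => j.
    by have := congr1 (@^~ (lift ord0 j)) exy; rewrite /e /fcons liftK.
  by exists (ts ord0, ts \o lift ord0); rewrite /e /= fcons_eta.
rewrite /prod_prob (reindex_esum _ _ _ _ e_bij).
pose a x (ts : 'I_n -> T) :=
  (pi ord0 x * \prod_(i < n) pi (lift ord0 i) (ts i))%:E.
transitivity (\esum_(x in [set: T]) \esum_(ts in [set ts | X (fcons x ts)]) a x ts).
  rewrite esum_esum; last first.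
    by move=> x ts _ _; rewrite lee_fin mulr_ge0 ?pmf_ge0 ?(prod_pmf_ge0 (pi \o _)).
  apply: eq_esum => k _; rewrite /a big_ord_recl {1}/e /fcons unlift_none.
  by under eq_bigr do rewrite /e /fcons liftK.
apply: eq_esum => x _; rewrite -esumZ_cond ?pmf_ge0//.
by move=> ts _; rewrite lee_fin (prod_pmf_ge0 (pi \o _)).
Qed.

(** Tonelli with the tail outermost, for changing the head factor under a fixed tail. *)
Lemma prod_probS_swap n (pi : 'I_n.+1 -> pdist R T) X :
  prod_prob pi X = \esum_(ts in [set: 'I_n -> T])
    ((\prod_(i < n) pi (lift ord0 i) (ts i))%:E *
     prob (pi ord0) [set x | X (fcons x ts)]).
Proof.
rewrite prod_probS /prod_prob /prob.
pose a x (ts : 'I_n -> T) := if ts \in [set ts | X (fcons x ts)] then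
  (pi ord0 x)%:E * (\prod_(i < n) pi (lift ord0 i) (ts i))%:E else 0.
have pr0 ts : (0 <= \prod_(i < n) pi (lift ord0 i) (ts i))%R.
  exact: (prod_pmf_ge0 (pi \o _)).
transitivity (\esum_(x in [set: T]) \esum_(ts in [set: 'I_n -> T]) a x ts).
  apply: eq_esum => x _; rewrite -esumZ_cond ?pmf_ge0// => [|ts _].
    exact: esum_mkcond.
  by rewrite lee_fin; exact: pr0.
rewrite esum_swap; last first.
  by move=> x ts; rewrite /a; case: ifP => // _; rewrite mule_ge0 ?lee_fin ?pmf_ge0.
apply: eq_esum => ts _; rewrite -esumZ_cond//; last first.
  by move=> x _; rewrite lee_fin pmf_ge0.
rewrite [RHS]esum_mkcond; apply: eq_esum => x _.
by rewrite /a muleC; congr (if _ then _ else _); apply/idP/idP => /set_mem ?; apply/mem_set.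
Qed.

(* Replacing one factor at a time needs no coupling: the bound for a factor is
   applied to the sections of [X]. *)
Lemma prod_prob_lift n (pi pi' : 'I_n -> pdist R T)
    (Q : 'I_n -> T -> T -> Prop) (e : 'I_n -> R) :
  (forall i, (0 <= e i)%R) ->
  (forall i X, prob (pi i) X <=
     prob (pi' i) [set y | exists2 x, X x & Q i x y] + (e i)%:E) ->
  forall X, prod_prob pi X <=
    prod_prob pi' [set us | exists2 ts, X ts & forall i, Q i (ts i) (us i)] +
    (\sum_(i < n) e i)%:E.
Proof.
elim: n pi pi' Q e => [|n IHn] pi pi' Q e e0 lift_pi X.
  rewrite big_ord0 adde0 /prod_prob.
  under eq_esum do rewrite big_ord0; under [leRHS]eq_esum do rewrite big_ord0.
  by apply: sub_esum => [t|ts Xts]; [rewrite lee_fin|exists ts => // -[]].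
(* Intermediate stage: [Y] moves only the tails of tuples in [X] along [Q], and [hyb] has the old
   head factor and the new tail factors. *)
pose Y : set ('I_n.+1 -> T) := [set v | exists2 ts, X (fcons (v ord0) ts) &
  forall i, Q (lift ord0 i) (ts i) (v (lift ord0 i))].
pose hyb i := if unlift ord0 i is Some j then pi' i else pi ord0.
have hyb0 : hyb ord0 = pi ord0 by rewrite /hyb unlift_none.
have hybS : hyb \o lift ord0 = pi' \o lift ord0.
  by apply/funext => j; rewrite /hyb /= liftK.
have e0S : (0 <= \sum_(i < n) e (lift ord0 i))%R by exact: sumr_ge0.
apply: (@le_trans _ _ (prod_prob hyb Y + (\sum_(i < n) e (lift ord0 i))%:E)).
  rewrite !prod_probS hyb0 hybS.
  (* The tail error is averaged over [pi ord0], of mass 1, so the bound can be checked for each head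
     [x]. *)
  rewrite -[X in _ + X]mul1e -(pmf_sum1 (pi ord0)) muleC -esumZ//; last first.
    by move=> t; rewrite lee_fin pmf_ge0.
  rewrite -esumD; first last.
  - by move=> t _; rewrite mule_ge0// lee_fin ?pmf_ge0.
  - move=> t _; rewrite mule_ge0// ?lee_fin ?pmf_ge0// esum_ge0// => ts _.
    by rewrite lee_fin prod_pmf_ge0.
  apply: le_esum => x _; rewrite [X in _ + X]muleC -ge0_muleDr; first last.
  - by rewrite lee_fin.
  - by rewrite esum_ge0// => ts _; rewrite lee_fin prod_pmf_ge0.
  apply: lee_wpmul2l; first by rewrite lee_fin pmf_ge0.
  have := IHn (pi \o lift ord0) (pi' \o lift ord0) (Q \o lift ord0) (e \o lift ord0).
  move=> /(_ (fun i => e0 _) (fun i => lift_pi _)) /(_ [set ts | X (fcons x ts)]).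
  move=> /le_trans; apply; apply: leeD2r.
  apply: sub_esum => [ts|ts [us Xus Qus]]; first by rewrite lee_fin prod_pmf_ge0.
  exists us => [|i]; first by rewrite /fcons unlift_none.
  by rewrite {1}/fcons liftK; exact: Qus.
rewrite big_ord_recl EFinD addeA; apply: leeD2r; rewrite !prod_probS_swap.
(* Likewise the head error is averaged over the new tail factors. *)
have -> : (e ord0)%:E = \esum_(ts in [set: 'I_n -> T])
    ((e ord0)%:E * (\prod_(i < n) pi' (lift ord0 i) (ts i))%:E).
  rewrite esumZ// ?(esum_prod1 (pi' \o lift ord0)) ?mule1// => ts.
  by rewrite lee_fin (prod_pmf_ge0 (pi' \o _)).
have pr0 ts : (0 <= \prod_(i < n) pi' (lift ord0 i) (ts i))%R.
  exact: (prod_pmf_ge0 (pi' \o _)).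
rewrite -esumD; first last.
- by move=> t _; rewrite mule_ge0// lee_fin.
- by move=> t _; rewrite mule_ge0 ?prob_ge0// lee_fin.
apply: le_esum => ts _.
under eq_bigr do rewrite -[hyb _]/((hyb \o lift ord0) _) hybS.
rewrite [X in _ + X]muleC -ge0_muleDr ?prob_ge0 ?lee_fin//.
apply: lee_wpmul2l; rewrite ?lee_fin//= hyb0.
apply: le_trans (lift_pi _ _) _; apply: leeD2r; apply: prob_sub.
move=> y [x [us Xus Qus] Qxy].
rewrite /fcons unlift_none in Xus.
exists (fcons x us) => // i; rewrite /fcons; case: unliftP => [j ->|-> //].
by have := Qus j; rewrite /fcons liftK.
Qed.

End product.

(** * Liftings on closed terms *)

Variable Sig : signature.
Local Notation cterm := (cterm Sig).

(** [papp pi] has mass only on terms headed by [f], which are in bijection with argument tuples. *)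
Lemma prob_papp (f : fname Sig) (pi : 'I_(arity f) -> pdist R cterm) X :
  prob (papp pi) X = prod_prob pi [set ts | X (App f ts)].
Proof.
rewrite /prod_prob.
transitivity (\esum_(t in App f @` [set ts | X (App f ts)]) (papp_pmf pi t)%:E).
  rewrite /prob esum_mkcond [RHS]esum_mkcond; apply: eq_esum => t _ /=.
  case: ifPn => [/set_mem Xt|/negP nXt]; case: ifPn => //.
  - move=> /negP nt; rewrite /papp_pmf; case E: args_of => [ts|//].
    by case: nt; apply/mem_set; exists ts; rewrite /= -(args_ofP E).
  - by move=> /set_mem[ts Xts tE]; case: nXt; apply/mem_set; rewrite -tE.
rewrite esum_image; first by apply: eq_esum => ts _; rewrite /papp_pmf args_ofK.
by move=> ts us _ _ /(congr1 (args_of f)); rewrite !args_ofK => -[].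
Qed.

(** The matching condition of [is_eps_bisim], with relation and error as separate parameters. *)
Definition lifted (Q : cterm -> cterm -> Prop) (e : R) (pi pi' : pdist R cterm) :=
  forall X, prob pi X <= prob pi' (rel_image Q X) + e%:E.

Lemma lifted_mono (Q Q' : cterm -> cterm -> Prop) e e' pi pi' :
  (forall t t', Q t t' -> Q' t t') -> (e <= e')%R ->
  lifted Q e pi pi' -> lifted Q' e' pi pi'.
Proof.
move=> QQ' ee' l X; apply: le_trans (l X) _; apply: leeD; last by rewrite lee_fin.
by apply: prob_sub => y [x Xx /QQ' Qxy]; exists x.
Qed.

Lemma lifted_ge1 (Q : cterm -> cterm -> Prop) e pi pi' :
  (1 <= e)%R -> lifted Q e pi pi'.
Proof.
move=> e1 X; apply: le_trans (prob_le1 _ _) _; apply: le_trans (leeDr _ (prob_ge0 _ _)).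
by rewrite lee_fin.
Qed.

Lemma lifted_dirac (Q : cterm -> cterm -> Prop) e t t' :
  (0 <= e)%R -> Q t t' -> lifted Q e (pdirac t) (pdirac t').
Proof.
move=> e0 Qtt' X; rewrite !prob_dirac.
have [/set_mem Xt|_] := boolP (t \in X).
  by rewrite mem_set ?leeDl ?lee_fin//; exists t.
by rewrite adde_ge0 ?lee_fin.
Qed.

Lemma lifted_refl (Q : cterm -> cterm -> Prop) e pi :
  (0 <= e)%R -> (forall t, Q t t) -> lifted Q e pi pi.
Proof.
move=> e0 Qrefl X; apply: (@le_trans _ _ (prob pi (rel_image Q X))).
  by apply: prob_sub => x Xx; exists x.
by rewrite leeDl// lee_fin.
Qed.

Lemma lifted_conv (Q : cterm -> cterm -> Prop) e (J : set nat) (p : nat -> R)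
    (p01 : forall i, J i -> (0 < p i <= 1)%R)
    (p1 : \esum_(i in J) (p i)%:E = 1) (pi pi' : nat -> pdist R cterm) :
  (0 <= e)%R -> (forall i, J i -> lifted Q e (pi i) (pi' i)) ->
  lifted Q e (pconv p01 p1 pi) (pconv p01 p1 pi').
Proof.
have p0 i : J i -> 0 <= (p i)%:E by move=> /p01/andP[/ltW]; rewrite lee_fin.
move=> e0 l X; rewrite !prob_conv.
(* The weights sum to 1, so [e] is its own average and the bounds add summand by summand. *)
have -> : e%:E = \esum_(i in J) ((p i)%:E * e%:E).
  under eq_esum do rewrite muleC.
  by rewrite esumZ_cond// p1 mule1.
rewrite -esumD; first last.
- by move=> i Ji; rewrite mule_ge0 ?p0// lee_fin.
- by move=> i Ji; rewrite mule_ge0 ?p0// prob_ge0.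
apply: le_esum => i Ji; rewrite -ge0_muleDr ?prob_ge0 ?lee_fin//.
by apply: lee_wpmul2l; [exact: p0|exact: l].
Qed.

Lemma lifted_app (f : fname Sig) (Q : cterm -> cterm -> Prop)
    (Qi : 'I_(arity f) -> cterm -> cterm -> Prop) (e : 'I_(arity f) -> R)
    (pi pi' : 'I_(arity f) -> pdist R cterm) :
  (forall i, (0 <= e i)%R) ->
  (forall ts ts', (forall i, Qi i (ts i) (ts' i)) -> Q (App f ts) (App f ts')) ->
  (forall i, lifted (Qi i) (e i) (pi i) (pi' i)) ->
  lifted Q (\sum_(i < arity f) e i)%R (papp pi) (papp pi').
Proof.
move=> e0 Qapp l X; rewrite !prob_papp.
apply: le_trans (prod_prob_lift e0 l _) _; apply: leeD2r.
apply: sub_esum => [ts|us [ts Xts Qts]]; first by rewrite lee_fin prod_pmf_ge0.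
by exists (App f ts) => //; exact: Qapp.
Qed.

End lifting.

(** * Closure of the bisimilarities under operators *)

Section congruence_closure.
Set Implicit Arguments.
Unset Strict Implicit.
Variables (R : realType) (Sig : signature) (A : countType).
Variable tr : set (transition R Sig A).

Lemma eps_bisimilar_sym e t t' :
  eps_bisimilar tr e t t' -> eps_bisimilar tr e t' t.
Proof. by case=> Q [Qsym Qtr] /Qsym Qt't; exists Q. Qed.

Lemma eps_bisimilar_mono e e' t t' : e <= e' ->
  eps_bisimilar tr e t t' -> eps_bisimilar tr e' t t'.
Proof.
move=> ee' [Q [Qsym Qtr] Qtt']; exists Q => //; split=> // u u' a pi Quu' upi.
have [pi' u'pi' l] := Qtr _ _ _ _ Quu' upi.
by exists pi' => //; exact: lifted_mono ee' l.
Qed.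

(* The alternative [1 <= e] caps the accumulated error at [1]. *)
Inductive congr_closure : R -> cterm Sig -> cterm Sig -> Prop :=
| CongrBisim e t t' of 0 <= e & eps_bisimilar tr e t t' : congr_closure e t t'
| CongrApp f (ts ts' : 'I_(arity f) -> cterm Sig) (es : 'I_(arity f) -> R) e of
    (forall i, 0 <= es i) & (forall i, congr_closure (es i) (ts i) (ts' i)) &
    \sum_(i < arity f) es i <= e \/ 1 <= e :
    congr_closure e (App f ts) (App f ts').

Lemma congr_closure_ge0 e t t' : congr_closure e t t' -> 0 <= e.
Proof.
case=> {e t t'} [//|f ts ts' es e es0 _ [|]]; apply: le_trans => //.
exact: sumr_ge0.
Qed.

Lemma congr_closure_mono e e' t t' : e <= e' ->
  congr_closure e t t' -> congr_closure e' t t'.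
Proof.
move=> + C; case: C => {t t'} [{}e t t' e0 b|f ts ts' es {}e es0 C e1] ee'.
  by apply: CongrBisim; [exact: le_trans ee'|exact: eps_bisimilar_mono b].
apply: CongrApp es0 C _.
by case: e1 => e1; [left|right]; exact: le_trans ee'.
Qed.

Lemma congr_closure_sym e t t' : congr_closure e t t' -> congr_closure e t' t.
Proof.
elim=> {e t t'} [e t t' e0 b|f ts ts' es e es0 _ C e1].
  by apply: CongrBisim => //; exact: eps_bisimilar_sym.
exact: CongrApp es0 C e1.
Qed.

Lemma congr_closure_refl e t : 0 <= e -> congr_closure e t t.
Proof.
move=> e0; apply: CongrBisim => //; exists eq => //; split=> // u _ a pi <- upi.
by exists pi => //; exact: lifted_refl.
Qed.

Lemma congr_closure_appE f ts e t' : congr_closure e (App f ts) t' ->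
  eps_bisimilar tr e (App f ts) t' \/
  exists ts' es, [/\ t' = App f ts', forall i, 0 <= es i,
    forall i, congr_closure (es i) (ts i) (ts' i) &
    \sum_(i < arity f) es i <= e \/ 1 <= e].
Proof.
move: {-2}(App f ts) (erefl (App f ts)) => t tE C; case: C tE => {e t t'}.
  by move=> e t t' _ b _; left.
move=> g us us' es e es0 C e1 tE; right.
(* The type of the arguments depends on the operator; [args_of] compares them once the two names are
   identified. *)
have := args_ofK ts; rewrite -tE /=; case: eqP => // gf.
by case: f / gf ts {tE} => ts [<-]; exists us', es.
Qed.

(** * Error of a rule target under a change of substitution *)

Section targets.
Variables (V D : choiceType) (rho : rule R Sig A V D).
Variable es : 'I_(arity (rop rho)) -> R.
Hypothesis es0 : forall i, 0 <= es i.

(** The error budget of [t]: each occurrence of the [i]-th source variable costs [es i]. *)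
Definition term_weight (t : term Sig V) : R :=
  \sum_(i < arity (rop rho)) (tmult t (rvar i))%:R * es i.

Lemma term_weight_ge0 t : 0 <= term_weight t.
Proof. by apply: sumr_ge0 => i _; rewrite mulr_ge0. Qed.

(* The left-hand side of the condition [eps_rule], summed over the source
   variables with coefficients [es], for a multiplicity function [m]. *)
Definition mult_weight (m : V + D -> \bar R) : \bar R :=
  (\sum_(i < arity (rop rho)) (es i)%:E * (m (inl (rvar i)) +
     \esum_(p in pprem rho) (((tmult p.1.1 (rvar i))%:R)%:E * m (inr p.2))))%E.

Lemma dmult_ge0 (th : dterm R Sig V D) z : (0 <= dmult th z)%E.
Proof.
elim: th => [mu|t|J p th IH p01 p1|f th IH] /=.
- by rewrite lee_fin.
- by case: z => // x; rewrite lee_fin.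
(* An empty [J] would give the supremum [-oo]; it is excluded because its weights would sum to 0. *)
- have [i Ji] : J !=set0.
    apply/set0P/eqP => J0; move: p1; rewrite J0 esum_set0 => -[].
    by move/eqP; rewrite eq_sym oner_eq0.
  by apply: le_trans (IH i) _; apply: ereal_sup_ubound; exists i.
- by apply: sume_ge0 => i _; exact: IH.
Qed.

Lemma mult_weight_le m m' : (forall z, m z <= m' z)%E ->
  (mult_weight m <= mult_weight m')%E.
Proof.
move=> mm'; apply: lee_sum => i _; apply: lee_wpmul2l; first by rewrite lee_fin.
apply: leeD => //; apply: le_esum => p _; exact: lee_wpmul2l.
Qed.

Lemma mult_weight_ge0 m : (forall z, 0 <= m z)%E -> (0 <= mult_weight m)%E.
Proof.
move=> m0; apply: sume_ge0 => i _; rewrite mule_ge0 ?lee_fin// adde_ge0//.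
by apply: esum_ge0 => p _; rewrite mule_ge0 ?lee_fin.
Qed.

Lemma mult_weight_sum n (m : 'I_n -> V + D -> \bar R) :
  (forall j z, 0 <= m j z)%E ->
  mult_weight (fun z => \sum_(j < n) m j z)%E = (\sum_(j < n) mult_weight (m j))%E.
Proof.
move=> m0; rewrite /mult_weight exchange_big /=; apply: eq_bigr => i _.
have t0 j p : (0 <= ((tmult p.1.1 (rvar i))%:R)%:E * m j (inr p.2))%E.
  by rewrite mule_ge0 ?lee_fin.
rewrite -ge0_sume_distrr; last first.
  by move=> j _; rewrite adde_ge0// esum_ge0.
rewrite big_split /=; congr (_ * (_ + _))%E.
rewrite -esum_sum//; apply: eq_esum => p _.
by rewrite ge0_sume_distrr.
Qed.

Lemma mult_weight_dirac t :
  ((term_weight t)%:E <= mult_weight (dmult (DDirac R D t)))%E.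
Proof.
rewrite /term_weight -sumEFin; apply: lee_sum => i _.
rewrite /= mulrC EFinM; apply: lee_wpmul2l; first by rewrite lee_fin.
by rewrite leeDl// esum_ge0// => p _; rewrite mule0.
Qed.

(** The target [p.2] has multiplicity 1 in itself, so the summand of the premise [p] alone already
    yields [term_weight p.1.1]. *)
Lemma mult_weight_var p : pprem rho p ->
  ((term_weight p.1.1)%:E <= mult_weight (dmult (DVar R Sig V p.2)))%E.
Proof.
move=> pp; rewrite /term_weight -sumEFin; apply: lee_sum => i _.
rewrite /= add0e mulrC EFinM; apply: lee_wpmul2l; first by rewrite lee_fin.
apply: esum_ge; exists [set p]; first by split=> // _ ->.
by rewrite fsbig_set1 eqxx mule1.
Qed.

Variables s s' : csubst R Sig V D.
Hypothesis ss'_source :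
  forall i, congr_closure (es i) (svar s (rvar i)) (svar s' (rvar i)).
Hypothesis ss'_other :
  forall x, (forall i : 'I_(arity (rop rho)), rvar i != x) -> svar s x = svar s' x.

(** Errors add over arguments by [CongrApp]; variables outside the source keep their value and cost
    nothing. *)
Lemma congr_closure_tsubst (t : term Sig V) :
  congr_closure (term_weight t) (tsubst (svar s) t) (tsubst (svar s') t).
Proof.
elim: t => [x|f ts IH] /=.
  have [[i <-]|nx] := pselect (exists i : 'I_(arity (rop rho)), rvar i = x).
    apply: congr_closure_mono (ss'_source i); rewrite /term_weight (bigD1 i)//=.
    by rewrite eqxx mul1r lerDl sumr_ge0// => j _; rewrite mulr_ge0.
  rewrite ss'_other; first exact/congr_closure_refl/term_weight_ge0.
  by move=> i; apply/eqP => ix; apply: nx; exists i.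
apply: CongrApp IH _ => [i|]; first exact: term_weight_ge0.
left; rewrite /term_weight exchange_big /= le_eqVlt; apply/orP; left; apply/eqP.
by apply: eq_bigr => i _; rewrite -mulr_suml natr_sum.
Qed.

Hypothesis ss'_prem : forall p, pprem rho p ->
  lifted (congr_closure (term_weight p.1.1)) (term_weight p.1.1)
    (dvar s p.2) (dvar s' p.2).
Hypothesis ss'_nprem :
  forall mu, (forall p, pprem rho p -> p.2 <> mu) -> dvar s mu = dvar s' mu.

(** Stated with a real bound [w], since multiplicities, and hence [mult_weight], may be infinite. *)
Lemma lifted_dsubst (th : dterm R Sig V D) w : (mult_weight (dmult th) <= w%:E)%E ->
  lifted (congr_closure w) w (dsubst s th) (dsubst s' th).
Proof.
have w_ge0 (th' : dterm R Sig V D) w' : (mult_weight (dmult th') <= w'%:E)%E -> 0 <= w'.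
  by rewrite -lee_fin; apply: le_trans; apply: mult_weight_ge0; exact: dmult_ge0.
elim: th w => [mu|t|J p th IH p01 p1|f th IH] w wle; have w0 := w_ge0 _ _ wle.
- rewrite /=; have [[p pp ?]|nmu] := pselect (exists2 p, pprem rho p & p.2 = mu).
    subst mu.
    have tw : term_weight p.1.1 <= w.
      by rewrite -lee_fin; apply: le_trans wle; exact: (mult_weight_var pp).
    apply: (lifted_mono _ tw (ss'_prem pp)) => u u'.
    exact: congr_closure_mono tw.
  rewrite ss'_nprem; first by apply: lifted_refl => // u; exact: congr_closure_refl.
  by move=> p pp pmu; apply: nmu; exists p.
- apply: lifted_dirac => //; apply: congr_closure_mono (congr_closure_tsubst t).
  by rewrite -lee_fin; apply: le_trans wle; exact: mult_weight_dirac.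
- apply: lifted_conv => // i Ji; apply: IH; apply: le_trans wle.
  by apply: mult_weight_le => z /=; apply: ereal_sup_ubound; exists i.
- move: wle; rewrite /= mult_weight_sum => [wle|j z]; last exact: dmult_ge0.
  have m0 i : (0 <= mult_weight (dmult (th i)))%E.
    by apply: mult_weight_ge0; exact: dmult_ge0.
  (* [fine] loses nothing: each operand's weight is bounded by the sum, hence by [w]. *)
  pose we i := fine (mult_weight (dmult (th i))).
  have weE i : (we i)%:E = mult_weight (dmult (th i)).
    rewrite fineK// ge0_fin_numE//; apply: le_lt_trans (ltry w).
    by apply: le_trans wle; rewrite (bigD1 i)//= leeDl// sume_ge0.
  have we0 i : 0 <= we i by rewrite -lee_fin weE.
  have wew : \sum_(i < arity f) we i <= w.
    by rewrite -lee_fin -sumEFin; under eq_bigr do rewrite weE.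
  apply: (@lifted_mono _ _ (congr_closure w) _ _ _ _ _ _ wew) => //.
  apply: (@lifted_app _ _ _ _ (fun i => congr_closure (we i))) => //.
    by move=> ts ts' C; apply: CongrApp we0 C _; left.
  by move=> i; apply: IH; rewrite weE.
Qed.

End targets.
End congruence_closure.

(** * Transfer of derivations along the closure *)

Section transfer.
Set Implicit Arguments.
Unset Strict Implicit.
Variables (R : realType) (Sig : signature) (A : countType) (V D : choiceType).
Variable P : ptss R Sig A V D.
Hypothesis P_eps : forall rho, P rho -> eps_rule rho.
Variable tr : set (transition R Sig A).
Hypothesis tr_provable : tr `<=` provable P tr.
Hypothesis provable_tr : provable P tr `<=` tr.

(** [eps_rule] bounds the coefficient of each [es i] by 1. *)
Lemma mult_weight_trg rho (es : 'I_(arity (rop rho)) -> R) : P rho ->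
  (forall i, 0 <= es i) ->
  (mult_weight es (dmult (trg rho)) <= (\sum_(i < arity (rop rho)) es i)%:E)%E.
Proof.
move=> Prho es0; rewrite -sumEFin; apply: lee_sum => i _.
rewrite -[leRHS]mule1; apply: lee_wpmul2l; first by rewrite lee_fin.
exact: P_eps.
Qed.

(** Induction on the proof tree. The oracle [N] and the predicate [K], inherited by positive
    premises, are left open because negative premises are treated in two different ways later. *)
Lemma transfer (N : set (transition R Sig A)) (K : transition R Sig A -> Prop) :
  N `<=` tr ->
  (forall rho (s : csubst R Sig V D) p, P rho -> pprem rho p ->
     K (conc s rho) -> K (pos_inst s p)) ->
  (forall rho (s s' : csubst R Sig V D) n e, P rho -> K (conc s rho) ->
     nprem rho n -> neg_holds s n tr ->
     congr_closure tr e (tsubst (svar s) n.1) (tsubst (svar s') n.1) ->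
     neg_holds s' n N) ->
  forall psi, tr psi -> K psi ->
  forall e t', congr_closure tr e psi.1.1 t' ->
    exists2 pi', provable P N (t', psi.1.2, pi') &
      lifted (congr_closure tr e) e psi.2 pi'.
Proof.
move=> Ntr Kpos Kneg psi /tr_provable; elim=> rho s Prho pos IH neg Kc e t' C.
have trc : tr (conc s rho) by apply: provable_tr; exact: Provable.
(* For bisimilar terms the bisimulation itself supplies the answer; only the operator case replays
   the rule. *)
have [[Q [Qsym Qtr] Qt]|[ts' [es [t'E es0 Ces e1]]]] := congr_closure_appE C.
  have [pi' t'pi' l] := Qtr _ _ _ _ Qt trc.
  exists pi'; first by apply: provable_antitone Ntr _ _; exact: tr_provable.
  apply: lifted_mono l => // u u' Quu'.
  by apply: CongrBisim; [exact: congr_closure_ge0 C|exists Q].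
subst t'.
(* The rule is replayed with [ts'] for the source variables and all other state variables
   unchanged. *)
pose sv' x := if [pick i | rvar i == x] is Some i then ts' i else svar s x.
have sv'_source i : sv' (rvar i) = ts' i.
  rewrite /sv'; case: pickP => [j /eqP/rvar_distinct -> //|/(_ i)].
  by rewrite eqxx.
have sv'_other x : (forall i : 'I_(arity (rop rho)), rvar i != x) -> svar s x = sv' x.
  by move=> nx; rewrite /sv'; case: pickP => // i; rewrite (negbTE (nx i)).
have Cs (s' : csubst R Sig V D) t : svar s' = sv' ->
    congr_closure tr (term_weight es t) (tsubst (svar s) t) (tsubst (svar s') t).
  move=> s'E; apply: congr_closure_tsubst => // [i|x]; rewrite s'E.
    by rewrite sv'_source; exact: Ces.
  exact: sv'_other.
(* Each [mu] belongs to at most one premise, so its new value can be taken from the induction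
   hypothesis of that premise. *)
have /choice[dv' dv'P] mu : exists pi',
    (forall p, pprem rho p -> p.2 = mu ->
       provable P N (tsubst sv' p.1.1, p.1.2, pi') /\
       lifted (congr_closure tr (term_weight es p.1.1)) (term_weight es p.1.1)
         (dvar s mu) pi') /\
    ((forall p, pprem rho p -> p.2 <> mu) -> dvar s mu = pi').
  have [[p pp pmu]|nmu] := pselect (exists2 p, pprem rho p & p.2 = mu); last first.
    by exists (dvar s mu); split=> // p pp pmu; case: nmu; exists p.
  (* [dvar s] is a placeholder: the source of a premise depends only on the state variables. *)
  have [pi' ppi' l] := IH p pp (Kpos _ _ _ Prho pp Kc) _ _
    (Cs (CSubst sv' (dvar s)) p.1.1 erefl).
  exists pi'; split=> [q qp qmu|/(_ p pp)//].
  have -> : q = p by apply: (pprem_distinct qp pp); rewrite qmu.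
  by rewrite -pmu.
pose s' := CSubst sv' dv'.
exists (dsubst s' (trg rho)).
  have -> : (App (rop rho) ts', (conc s rho).1.2, dsubst s' (trg rho)) = conc s' rho.
    rewrite /conc /=; congr (App _ _, _, _).
    by apply/funext => i; rewrite sv'_source.
  apply: Provable => // [p pp|n nn].
    exact: ((dv'P p.2).1 p pp erefl).1.
  by apply: (Kneg rho s s' n _ Prho Kc nn (neg n nn)); exact: (Cs s').
(* Once the error reaches 1, any two distributions are related. *)
case: e1 => e1; last exact: lifted_ge1.
apply: (@lifted_mono _ _ (congr_closure tr (\sum_(i < arity (rop rho)) es i)) _ _ _ _ _ _ e1).
  by move=> u u'; exact: congr_closure_mono e1.
apply: (@lifted_dsubst _ _ _ _ _ _ rho es) => // [i|p pp|mu|].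
- by rewrite /= sv'_source; exact: Ces.
- exact: ((dv'P p.2).1 p pp erefl).2.
- exact: (dv'P mu).2.
- exact: mult_weight_trg.
Qed.

Variables (W : wellOrder) (S : transition R Sig A -> W).
Hypothesis S_strat : is_stratification P S.

(* Negative premises are handled by alternating with an overapproximation of
   [tr]: the transfer into what is provable when negative premises only see
   strata below [b] uses the strata below [b], and in turn refutes the
   transitions that a negative premise at stratum [b] forbids. *)
Lemma congr_closure_transfer psi : tr psi ->
  forall e t', congr_closure tr e psi.1.1 t' ->
    exists2 pi', tr (t', psi.1.2, pi') &
      lifted (congr_closure tr e) e psi.2 pi'.
Proof.
suff H b : forall phi, tr phi -> (S phi <= b)%O ->
    forall e t', congr_closure tr e phi.1.1 t' ->
    exists2 pi', tr (t', phi.1.2, pi') & lifted (congr_closure tr e) e phi.2 pi'.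
  by move=> trpsi; exact: (H (S psi)).
elim/(well_founded_ind (wo_wf (w:=W))): b => b IHb.
pose N := [set phi | tr phi /\ (S phi < b)%O].
(* Shrinking the oracle only adds provable transitions, so [provable P N] contains [tr]; hence
   [over] can hold at every level. *)
have over phi : tr phi -> forall e t', congr_closure tr e phi.1.1 t' ->
    exists2 pi', provable P N (t', phi.1.2, pi') &
      lifted (congr_closure tr e) e phi.2 pi'.
  move=> trphi; apply: (@transfer N (fun=> True)) => // [psi' []//|].
  move=> rho s s' n e Prho _ nn neg /congr_closure_sym C pi [trpi Spi].
  by have [pi' + _] := IHb _ Spi _ trpi (lexx _) _ _ C; exact: neg.
move=> phi trphi Sb e t' C.
have [||pi' /provable_tr ? ?] :=
    @transfer tr (fun psi' => (S psi' <= b)%O) (fun _ h => h) _ _ phi trphi Sb e t' C.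
- move=> rho s p Prho pp; apply: le_trans.
  by have [+ _] := S_strat s Prho; exact.
- move=> rho s s' n e' Prho Sc nn neg /congr_closure_sym C' pi trpi.
  (* Stratification does not bound the level of the violating transition by [b], since it starts
     from the [s'] instance. [over] carries it back to [s], where the level is below [b] and
     [provable_below] replaces [N] by [tr]. *)
  have [pi' + _] := over _ trpi _ _ C' => /(provable_below S_strat) prov.
  apply: (neg pi'); apply: provable_tr; apply: prov.
  apply/ltW; apply: lt_le_trans Sc.
  by have [_ +] := S_strat s Prho; exact.
- by exists pi'.
Qed.

End transfer.

(** * Non-expansiveness of the operators *)

Theorem theorem3 (R : realType) (Sig : signature) (A : countType)
    (V D : choiceType)
    (V_infinite : infinite_set [set: V]) (D_infinite : infinite_set [set: D])
    (P : ptss R Sig A V D)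
    (P_eps : forall rho, P rho -> eps_rule rho)
    (W : wellOrder) (S : transition R Sig A -> W)
    (S_strat : is_stratification P S)
    (O : wellOrder) (deg : O) (deg_P : is_degree P deg)
    (f : fname Sig) (t t' : 'I_(arity f) -> cterm Sig)
    (e : 'I_(arity f) -> R)
    (e01 : forall i, 0 <= e i <= 1)
    (tt' : forall i, eps_bisimilar (induced P S deg) (e i) (t i) (t' i)) :
  eps_bisimilar (induced P S deg) (Num.min (\sum_(i < arity f) e i) 1)
    (App f t) (App f t').
Proof.
have tr_prov := induced_provable S_strat (deg := deg).
have prov_tr := provable_induced S_strat deg_P.
have es0 i : 0 <= e i by have /andP[] := e01 i.
set tr := induced P S deg in tt' tr_prov prov_tr *.
set m := Num.min _ _.
exists (congr_closure tr m); first split.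
- by move=> u u'; exact: congr_closure_sym.
- move=> u u' a pi C upi.
  have [pi' u'pi' l] :=
    congr_closure_transfer P_eps tr_prov prov_tr S_strat upi C.
  by exists pi'.
- apply: (@CongrApp _ _ _ _ _ _ _ e) => //.
    by move=> i; apply: CongrBisim.
  (* Either the sum is at most 1 and equals [m], or [m] is 1 and the cap applies. *)
  by rewrite /m; case: (leP _ 1) => _; [left|right]; exact: lexx.
Qed.
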